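(* Let $G$ be a group and let $\varphi:G\to G$ be an automorphism. Assume that for every countable subgroup $H\leq G$ there is a bi-order of $H^\varphi$ that is invariant under $\varphi$. Then $G$ supports a bi-order that is invariant under $\varphi$.
   Context: A bi-order on a group $K$ is a total order $\preceq$ on $K$ such that $g_1\prec g_2$ implies $g_3g_1\prec g_3g_2$ and $g_1g_3\prec g_2g_3$ for all $g_1,g_2,g_3\in K$. For a subgroup $H\leq G$, $H^\varphi=\langle \varphi^n(H)\mid n\in\mathbb{Z}\rangle$ denotes the subgroup of $G$ generated by all the images $\varphi^n(H)$, $n\in\mathbb{Z}$; note that $\varphi$ restricts to an automorphism of $H^\varphi$. A bi-order $\preceq$ on $G$ (or on $H^\varphi$) is invariant under $\varphi$ if $x\prec y$ implies $\varphi(x)\prec \varphi(y)$ for all $x,y$ in that group. *)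

(* Defs.v *)
From mathcomp Require Import all_boot all_order all_algebra.
From mathcomp Require Import boolp classical_sets functions cardinality.

Set Implicit Arguments.
Unset Strict Implicit.
Unset Printing Implicit Defensive.

Local Open Scope group_scope.
Local Open Scope classical_set_scope.

Definition subgroup (G : groupType) (H : set G) : Prop := group_closed [in H].

Definition generated (G : groupType) (A : set G) : set G :=
  smallest (@subgroup G) A.

(* phi^n for n : int.  ['pinv_id setT phi] is the two-sided inverse of phi
   whenever phi is bijective, and [Negz k] is the integer -(k+1). *)
Definition iterz (T : Type) (phi : T -> T) (n : int) : T -> T :=
  match n with
  | Posz k => iter k phi
  | Negz k => iter k.+1 ('pinv_id setT phi)
  end.

Definition orbit_subgroup (G : groupType) (phi : G -> G) (H : set G) : set G :=
  generated (\bigcup_(n : int) (iterz phi n @` H)).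

Definition strict (T : Type) (le : T -> T -> Prop) (x y : T) : Prop :=
  le x y /\ x <> y.

(* Orders on a subset K are represented by relations on the ambient type, of
   which only the values on K matter.  Reflexivity on K is the case x = y of
   [total_on]. *)
Definition total_order_on (T : Type) (K : set T) (le : T -> T -> Prop) : Prop :=
  [/\ total_on K le,
      forall x y, K x -> K y -> le x y -> le y x -> x = y
    & forall x y z, K x -> K y -> K z -> le x y -> le y z -> le x z].

Definition bi_order_on (G : groupType) (K : set G) (le : G -> G -> Prop) : Prop :=
  total_order_on K le /\
  forall g1 g2 g3, K g1 -> K g2 -> K g3 -> strict le g1 g2 ->
    strict le (g3 * g1) (g3 * g2) /\ strict le (g1 * g3) (g2 * g3).

Definition invariant_on (T : Type) (K : set T) (phi : T -> T)
    (le : T -> T -> Prop) : Prop :=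
  forall x y, K x -> K y -> strict le x y -> strict le (phi x) (phi y).

(* Main.v *)
Require Import Defs.
From mathcomp Require Import all_boot all_order all_algebra.
From mathcomp Require Import boolp classical_sets functions cardinality filter.

(** Being an invariant bi-order is a universal condition that involves only
    finitely many elements at a time, so a compactness argument applies, here
    in the form of an ultraproduct.  Every finite list [s] of elements of [G]
    lies in a countable subgroup [H] ([countable_subgroup_through]), and the
    hypothesis orders [orbit_subgroup phi H], hence orders a set that contains
    [s].  Take an ultrafilter on the finite lists which, for each [g], contains
    the lists through [g] ([seq_ultrafilter]), and declare [x] below [y] when
    the order attached to [s] says so for almost all [s].  For any three
    elements, almost every local order is defined on all of them; the axioms
    therefore pass to the limit order, totality being the one for which the
    filter has to be ultra ([bi_order_of_local]). *)

Set Implicit Arguments.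
Unset Strict Implicit.
Unset Printing Implicit Defensive.

Local Open Scope group_scope.
Local Open Scope classical_set_scope.

(** The subgroup consists of the values of the words in the entries of [s] and
    their inverses.  A letter is coded by a sign and a position in [s], so that
    the words form a countable type even though [G] need not be countable. *)
Lemma countable_subgroup_through (G : groupType) (s : seq G) :
  exists H : set G,
    [/\ subgroup H, countable H & forall g, g \in s -> H g].
Proof.
pose letter (c : bool * nat) : G :=
  if c.1 then (nth 1 s c.2)^-1 else nth 1 s c.2.
pose value (w : seq (bool * nat)) : G := \prod_(c <- w) letter c.
have valueV w : exists w', value w' = (value w)^-1.
  exists (rev [seq (~~ c.1, c.2) | c <- w]); elim: w => [|[b i] w IHw].
    by rewrite /value !big_nil invg1.
  rewrite /value big_cons invgM -IHw /= rev_cons -cats1 big_cat /= big_seq1.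
  by congr (_ * _); rewrite /letter; case: b => /=; rewrite ?invgK.
exists (range value); split.
- split; first by rewrite inE; exists [::] => //; rewrite /value big_nil.
  move=> x y; rewrite !inE => -[w1 _ <-] [w2 _ <-].
  have [w2' <-] := valueV w2.
  by exists (w1 ++ w2') => //; rewrite /value big_cat.
- exact: card_le_trans (card_image_le _ _) (countableP _).
- move=> g gs; exists [:: (false, index g s)] => //.
  by rewrite /value big_seq1 /letter /= nth_index.
Qed.

Lemma seq_ultrafilter (T : eqType) :
  exists U : set_system (seq T),
    UltraFilter U /\ forall x, U [set s | x \in s].
Proof.
pose base (t : seq T) := [set s : seq T | {subset t <= s}].
have Fproper : ProperFilter (filter_from setT base).
  apply: filter_from_proper; last by move=> t _; exists t.
  apply: filter_from_filter; first by exists [::].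
  move=> t1 t2 _ _; exists (t1 ++ t2) => // s t12s.
  by split=> x xt; apply: t12s; rewrite mem_cat xt ?orbT.
have [U [Uultra FU]] := ultraFilterLemma Fproper.
exists U; split=> // x; apply: FU; exists [:: x] => // s; apply.
exact: mem_head.
Qed.

(** The order on [G] is the restriction to constant families of the order on the
    ultraproduct of the [ord s]; [memK] makes each constant family live in
    [K s] for almost all [s]. *)
Lemma bi_order_of_local (G : groupType) (phi : G -> G)
    (K : seq G -> set G) (ord : seq G -> G -> G -> Prop)
    (memK : forall s g, g \in s -> K s g)
    (ord_bi : forall s, bi_order_on (K s) (ord s))
    (ord_inv : forall s, invariant_on (K s) phi (ord s)) :
  exists le : G -> G -> Prop,
    bi_order_on setT le /\ invariant_on setT phi le.
Proof.
have [U [Uultra Umem]] := seq_ultrafilter G.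
have UK g : U [set s | K s g] by apply: filterS (Umem g) => s; apply: memK.
pose le x y := U [set s | ord s x y].
(* A sentence that holds for almost all [s] and does not mention [s] is true:
   this yields the disequality hidden in [strict]. *)
have strictE x y : strict le x y <-> U [set s | strict (ord s) x y].
  split=> [[lexy nxy]|Uxy]; first by apply: filterS lexy.
  split; first by apply: filterS Uxy => s [].
  by have [s []] := filter_ex Uxy.
exists le; split; first split; first split.
- move=> x y _ _.
  have [|Unxy] := in_ultra_setVsetC [set s | ord s x y] Uultra; first by left.
  right; apply: filterS3 Unxy (UK x) (UK y) => s nxy Kx Ky.
  by have [[tot _ _] _] := ord_bi s; have [] := tot x y Kx Ky.
- move=> x y _ _ lexy leyx.
  have [s [[Kx Ky] [xy yx]]] :=
    filter_ex (filterI (filterI (UK x) (UK y)) (filterI lexy leyx)).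
  by have [[_ anti _] _] := ord_bi s; apply: anti.
- move=> x y z _ _ _ lexy leyz.
  apply: filterS2 (filterI lexy leyz)
                  (filterI (UK x) (filterI (UK y) (UK z))) => s.
  move=> [xy yz] [Kx [Ky Kz]].
  by have [[_ _ trans] _] := ord_bi s; apply: trans xy yz.
- move=> g1 g2 g3 _ _ _ /strictE lt12.
  have U_mul : U [set s | strict (ord s) (g3 * g1) (g3 * g2) /\
                          strict (ord s) (g1 * g3) (g2 * g3)].
    apply: filterS2 lt12 (filterI (UK g1) (filterI (UK g2) (UK g3))) => s.
    by move=> lt12s [K1 [K2 K3]]; have [_] := ord_bi s; apply.
  by split; apply/strictE; apply: filterS U_mul => s [].
- move=> x y _ _ /strictE ltxy; apply/strictE.
  by apply: filterS3 ltxy (UK x) (UK y) => s ltxys Kx Ky; apply: ord_inv.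
Qed.

Lemma sub_orbit_subgroup (G : groupType) (phi : G -> G) (H : set G) :
  H `<=` orbit_subgroup phi H.
Proof. by move=> g Hg; apply: sub_gen_smallest; exists (Posz 0) => //; exists g. Qed.

Theorem theorem4p1 (G : groupType) (phi : {multiplicative G -> G})
    (phi_bij : bijective phi)
    (local_orders : forall H : set G, subgroup H -> countable H ->
       exists le : G -> G -> Prop,
         bi_order_on (orbit_subgroup phi H) le /\
         invariant_on (orbit_subgroup phi H) phi le) :
  exists le : G -> G -> Prop,
    bi_order_on setT le /\ invariant_on setT phi le.
Proof.
have local (s : seq G) : exists Kle : set G * (G -> G -> Prop),
    [/\ forall g, g \in s -> Kle.1 g, bi_order_on Kle.1 Kle.2
      & invariant_on Kle.1 phi Kle.2].
  have [H [Hsub Hcount sH]] := countable_subgroup_through s.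
  have [le [le_bi le_inv]] := local_orders H Hsub Hcount.
  exists (orbit_subgroup phi H, le); split=> // g /sH.
  exact: sub_orbit_subgroup.
have [Kle KleP] := choice local.
by apply: (@bi_order_of_local G phi (fst \o Kle) (snd \o Kle)) => s;
  have [] := KleP s.
Qed.
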